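(* Let $\mathfrak{A}$ be a $\mathrm{C}^*$-algebra. Let $\pi$ be a finite-dimensional irreducible $*$-representation of $\mathfrak{A}$ with support projection $\mathfrak{s}_\pi$ lying in $\mathfrak{A}$. Then, $\mathfrak{s}_\pi$ peaks strongly at $\pi$.
   Context: Support projection: the bidual $\mathfrak{A}^{**}$ is a von Neumann algebra containing $\mathfrak{A}$ canonically. For a $*$-representation $\pi:\mathfrak{A}\to B(\mathcal{H}_\pi)$, the map $\pi^{**}:\mathfrak{A}^{**}\to B(\mathcal{H}_\pi)^{**}$ is a weak-$*$ continuous $*$-representation, and there is a central projection $\mathfrak{e}_\pi\in\mathfrak{A}^{**}$ with $\mathfrak{e}_\pi\mathfrak{A}^{**}=\ker\pi^{**}=(\ker\pi)^{\perp\perp}$. The support projection of $\pi$ is $\mathfrak{s}_\pi=I-\mathfrak{e}_\pi\in\mathfrak{A}^{**}$. An element $T\in\mathbb{M}_n(\mathfrak{A})$ peaks strongly at an irreducible $*$-representation $\pi$ of $\mathfrak{A}$ if $\|\pi^{(n)}(T)\|>\sup_\sigma\|\sigma^{(n)}(T)\|$, the supremum being over all irreducible $*$-representations $\sigma$ of $\mathfrak{A}$ not unitarily equivalent to $\pi$; here $\sigma^{(n)}$ is the entrywise ampliation of $\sigma$ to $\mathbb{M}_n(\mathfrak{A})$. *)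

(* Defs.v *)
From HB Require Import structures.
From mathcomp Require Import all_boot all_order all_algebra complex ring lra.
From mathcomp Require Import all_classical all_reals all_analysis.

Set Implicit Arguments.
Unset Strict Implicit.
Unset Printing Implicit Defensive.

Import Order.TTheory GRing.Theory Num.Theory.
Import numFieldNormedType.Exports.

Local Open Scope classical_set_scope.
Local Open Scope complex_scope.
Local Open Scope ring_scope.

(* Norms of [normedModType R[i]] are valued in R[i]; [rnorm] is the same number
   seen in R. *)
Definition rnorm (R : realType) (V : normedModType R[i]) (x : V) : R :=
  complex.Re `|x|.

Section RnormTheory.
Variables (R : realType) (V : normedModType R[i]).
Implicit Types x y : V.

Lemma rnormE x : `|x| = (rnorm x)%:C.
Proof. by rewrite /rnorm RRe_real // normr_real. Qed.

Lemma rnorm_ge0 x : 0 <= rnorm x.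
Proof. by rewrite -ler0c -rnormE. Qed.

Lemma rnormD x y : rnorm (x + y) <= rnorm x + rnorm y.
Proof. by rewrite -lecR rmorphD /= -!rnormE ler_normD. Qed.

Lemma rnormZ (c : R[i]) x : rnorm (c *: x) = complex.Re `|c| * rnorm x.
Proof. by apply: complexI; rewrite rmorphM /= -!rnormE normrZ. Qed.

Lemma rnorm0 : rnorm (0 : V) = 0.
Proof. by rewrite /rnorm normr0. Qed.

Lemma rnorm_eq0 x : rnorm x = 0 -> x = 0.
Proof. by move=> x0; apply/eqP; rewrite -normr_eq0 rnormE x0. Qed.

End RnormTheory.

Section BoundedOperators.
Variables (R : realType) (V W : normedModType R[i]).

Definition blin_pred : {pred V -> W} :=
  fun f => `[< linear f /\ continuous f >].

Record blin := Blin { blin_fun :> V -> W; _ : blin_fun \in blin_pred }.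

HB.instance Definition _ := [isSub for blin_fun].
HB.instance Definition _ := [Choice of blin by <:].

Lemma blin_submod_closed : submod_closed blin_pred.
Proof.
split=> [|c f g /asboolP [lf cf] /asboolP [lg cg]]; apply/asboolP; split.
- by move=> a x y; rewrite scaler0 addr0.
- exact: cst_continuous.
- move=> a x y; rewrite !fctE lf lg !scalerDr addrACA.
  by rewrite !scalerA (mulrC c).
- by move=> x; apply: continuousD (cg x); apply: continuous_comp (cf x) _;
  exact: scaler_continuous.
Qed.

HB.instance Definition _ :=
  GRing.isSubmodClosed.Build _ _ blin_pred blin_submod_closed.
HB.instance Definition _ := [SubChoice_isSubLmodule of blin by <:].

Lemma blin_linear (f : blin) : linear f.
Proof. by case: f => f /= /asboolP []. Qed.

HB.instance Definition _ (f : blin) :=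
  GRing.isLinear.Build _ _ _ _ (f : V -> W) (blin_linear f).

Lemma blin_continuous (f : blin) : continuous f.
Proof. by case: f => f /= /asboolP []. Qed.

Lemma blinP (f g : blin) : f =1 g <-> f = g.
Proof.
by split=> [fg|->//]; apply/val_inj/funext.
Qed.

Lemma blinDE (f g : blin) x : (f + g) x = f x + g x. Proof. by []. Qed.
Lemma blinNE (f : blin) x : (- f) x = - f x. Proof. by []. Qed.
Lemma blinZE c (f : blin) x : (c *: f) x = c *: f x. Proof. by []. Qed.
Lemma blin0E x : (0 : blin) x = 0. Proof. by []. Qed.

Lemma bound_mem_blin (f : V -> W) (M : R) : linear f ->
  (forall x, rnorm (f x) <= M * rnorm x) -> f \in blin_pred.
Proof.
move=> lf fM; apply/asboolP; split=> //.
pose g : {linear V -> W} := HB.pack f (GRing.isLinear.Build _ _ _ _ _ lf).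
suff: continuous g by [].
apply: bounded_linear_continuous; apply/linear_boundedP.
near=> r => x.
apply: (@le_trans _ _ (M%:C * `|x|)); last first.
  by rewrite ler_wpM2r //; near: r; apply: nbhs_pinfty_ge; rewrite complex_real.
by rewrite !rnormE -rmorphM lecR.
Unshelve. all: by end_near. Qed.

Lemma blin_bounded (f : blin) :
  exists2 M : R, 0 <= M & forall x, rnorm (f x) <= M * rnorm x.
Proof.
have /linear_bounded_continuous/linear_boundedP := @blin_continuous f.
move=> /pinfty_ex_gt0[M M0 fM].
have MC : (complex.Re M)%:C = M by rewrite RRe_real // gtr0_real.
exists (complex.Re M); first by rewrite -ler0c MC ltW.
by move=> x; rewrite -lecR rmorphM /= MC -!rnormE; exact: fM.
Qed.

(* The operator norm. *)
Definition opnorm (f : blin) : R :=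
  sup [set rnorm (f x) | x in [set x | rnorm x <= 1]].

Lemma opnorm_has_sup (f : blin) :
  has_sup [set rnorm (f x) | x in [set x | rnorm x <= 1]].
Proof.
split; first by exists (rnorm (f 0)), 0 => //=; rewrite rnorm0.
have [M M0 fM] := blin_bounded f; exists M => _ [x /= x1 <-].
by apply: (le_trans (fM x)); rewrite ler_piMr.
Qed.

Lemma opnorm_ge0 f : 0 <= opnorm f.
Proof.
have /ub_le_sup : has_ubound [set rnorm (f x) | x in [set x | rnorm x <= 1]].
  by case: (opnorm_has_sup f).
apply; exists 0; first by rewrite /= rnorm0.
by rewrite linear0 rnorm0.
Qed.

Lemma opnormP (f : blin) x : rnorm (f x) <= opnorm f * rnorm x.
Proof.
have [->|x0] := eqVneq x 0; first by rewrite linear0 !rnorm0 mulr0.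
have nx0 : 0 < rnorm x.
  by rewrite lt_def rnorm_ge0 andbT; apply: contra_neq x0; apply: rnorm_eq0.
pose c : R[i] := (rnorm x)^-1%:C.
have cE : complex.Re `|c| = (rnorm x)^-1.
  by rewrite ger0_norm // ler0c invr_ge0 ltW.
rewrite -ler_pdivrMr // mulrC -cE -rnormZ -linearZ.
apply: ub_le_sup; first by case: (opnorm_has_sup f).
by exists (c *: x) => //=; rewrite rnormZ cE mulVf // gt_eqF.
Qed.

Lemma opnorm_le (f : blin) (M : R) :
  (forall x, rnorm x <= 1 -> rnorm (f x) <= M) -> opnorm f <= M.
Proof.
move=> fM; apply: ge_sup; first by case: (opnorm_has_sup f).
by move=> _ [x /= x1 <-]; apply: fM.
Qed.

Lemma opnormD (f g : blin) : opnorm (f + g) <= opnorm f + opnorm g.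
Proof.
apply: opnorm_le => x x1; apply: (le_trans (rnormD _ _)).
by apply: lerD; apply: (le_trans (opnormP _ _)); rewrite ler_piMr // opnorm_ge0.
Qed.

Lemma opnorm_eq0 f : opnorm f = 0 -> f = 0.
Proof.
move=> f0; apply/blinP => x; apply: rnorm_eq0; apply/eqP.
by rewrite eq_le rnorm_ge0 andbT; have := opnormP f x; rewrite f0 mul0r.
Qed.

Lemma opnormZ c (f : blin) : opnorm (c *: f) = complex.Re `|c| * opnorm f.
Proof.
have Hle d g : opnorm (d *: g) <= complex.Re `|d| * opnorm g.
  have d0 : 0 <= complex.Re `|d| by rewrite -ler0c RRe_real // normr_real.
  apply: opnorm_le => x x1; rewrite blinZE rnormZ; apply: ler_wpM2l => //.
  by apply: (le_trans (opnormP _ _)); rewrite ler_piMr // opnorm_ge0.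
apply/eqP; rewrite eq_le Hle andTb.
have [->|c0] := eqVneq c 0.
  by rewrite normr0 mul0r opnorm_ge0.
have := Hle c^-1 (c *: f); rewrite scalerA mulVf // scale1r.
have nc0 : 0 < complex.Re `|c|.
  by rewrite -ltcR RRe_real ?normr_real // normr_gt0.
have -> : complex.Re `|c^-1| = (complex.Re `|c|)^-1.
  by apply: complexI; rewrite fmorphV; exact: normfV.
by rewrite ler_pdivlMl.
Qed.

Let cnorm (f : blin) : R[i] := (opnorm f)%:C.

Let cnormD f g : cnorm (f + g) <= cnorm f + cnorm g.
Proof. by rewrite -rmorphD lecR opnormD. Qed.

Let cnormZ (c : R[i]) f : cnorm (c *: f) = `|c| * cnorm f.
Proof.
by rewrite /cnorm opnormZ rmorphM.
Qed.

Let cnorm_eq0 f : cnorm f = 0 -> f = 0.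
Proof. by move=> /complexI /opnorm_eq0. Qed.

HB.instance Definition _ :=
  Lmodule_isNormed.Build R[i] blin cnormD cnormZ cnorm_eq0.

Lemma rnorm_blin (f : blin) : rnorm f = opnorm f.
Proof. by []. Qed.

End BoundedOperators.

HB.mixin Record isCstarAlgebra (R : realType) A
    & CompleteNormedModule R[i] A := {
  cmul : A -> A -> A;
  cmulA : associative cmul;
  cmul_linearl : forall b, linear (cmul^~ b);
  cmul_linearr : forall a, linear (cmul a);
  cstar : A -> A;
  cstarK : involutive cstar;
  cstarD : {morph cstar : a b / a + b};
  cstarZ : forall (c : R[i]) a, cstar (c *: a) = c^*%C *: cstar a;
  cstarM : forall a b, cstar (cmul a b) = cmul (cstar b) (cstar a);
  cnormM : forall a b, `|cmul a b| <= `|a| * `|b|;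
  cnorm_star : forall a, `|cmul (cstar a) a| = `|a| ^+ 2
}.

(* Not assumed unital, and possibly zero. *)
#[short(type="cstarAlgType")]
HB.structure Definition CstarAlgebra (R : realType) :=
  {A of isCstarAlgebra R A & CompleteNormedModule R[i] A}.

HB.instance Definition _ (R : realType) (A : cstarAlgType R) :=
  bilinear_isBilinear.Build R[i] A A A *:%R *:%R (@cmul R A)
    (@cmul_linearl R A, @cmul_linearr R A).

(* The inner product is linear in its first argument. *)
HB.mixin Record isHilbert (R : realType) H & CompleteNormedModule R[i] H := {
  hdot : H -> H -> R[i];
  hdot_linear : forall y, scalar (hdot^~ y);
  hdot_sym : forall x y, hdot x y = (hdot y x)^*%C;
  hdot_norm : forall x, hdot x x = `|x| ^+ 2
}.

#[short(type="hilbertType")]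
HB.structure Definition Hilbert (R : realType) :=
  {H of isHilbert R H & CompleteNormedModule R[i] H}.

Section HilbertTheory.
Variables (R : realType) (H : hilbertType R).

Let hdot_linearr (x : H) :
  GRing.linear_for (@conjc R \; *%R) (@hdot R H x).
Proof.
move=> c y z; rewrite hdot_sym hdot_linear rmorphD rmorphM /=.
by rewrite -!hdot_sym.
Qed.

HB.instance Definition _ :=
  bilinear_isBilinear.Build R[i] H H R[i] *%R (@conjc R \; *%R) (@hdot R H)
    (@hdot_linear R H, hdot_linearr).

Let hdot_hermitian (x y : H) : hdot x y = (-1) ^+ false * (hdot y x)^*%C.
Proof. by rewrite expr0 mul1r hdot_sym. Qed.

HB.instance Definition _ := isHermitianSesquilinear.Build R[i] H false
  (@conjc R) (@hdot R H) hdot_hermitian.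

Let hdot_gt0 (x : H) : x != 0 -> 0 < hdot x x.
Proof. by move=> x0; rewrite hdot_norm exprn_gt0 // normr_gt0. Qed.

HB.instance Definition _ := isDotProduct.Build R[i] H (@hdot R H) hdot_gt0.

Lemma rhdot_norm (x : H) : hdot x x = (rnorm x ^+ 2)%:C.
Proof. by apply: (etrans (hdot_norm x)); rewrite rnormE -rmorphXn. Qed.

End HilbertTheory.

Record star_rep (R : realType) (A : cstarAlgType R) (H : hilbertType R) :=
  StarRep {
    rep_fun :> {linear A -> blin H H};
    rep_mul : forall a b x, rep_fun (cmul a b) x = rep_fun a (rep_fun b x);
    rep_star : forall a x y,
      hdot (rep_fun (cstar a) x) y = hdot x (rep_fun a y)
  }.

Section CstarTheory.
Variables (R : realType) (A : cstarAlgType R).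
Implicit Types a b : A.

Lemma cstarB a b : cstar (a - b) = cstar a - cstar b.
Proof. by rewrite -scaleN1r cstarD cstarZ rmorphN1 scaleN1r. Qed.

Lemma rcnormM a b : rnorm (cmul a b) <= rnorm a * rnorm b.
Proof. by have := cnormM a b; rewrite !rnormE -rmorphM lecR. Qed.

Lemma rcnorm_star a : rnorm (cmul (cstar a) a) = rnorm a ^+ 2.
Proof. by have := cnorm_star a; rewrite !rnormE -rmorphXn => /complexI. Qed.

Lemma rnorm_cstar a : rnorm (cstar a) = rnorm a.
Proof.
have le b : rnorm b <= rnorm (cstar b).
  have [->|b0] := eqVneq b 0; first by rewrite rnorm0 rnorm_ge0.
  have nb0 : 0 < rnorm b.
    by rewrite lt_def rnorm_ge0 andbT; apply: contra_neq b0; apply: rnorm_eq0.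
  by rewrite -(ler_pM2r nb0) -expr2 -rcnorm_star rcnormM.
by apply/eqP; rewrite eq_le le andbT; have := le (cstar a); rewrite cstarK.
Qed.

End CstarTheory.

(* A *-representation is automatically bounded: if |b| <= 1/4, b = b^*, then
   b = 2 d - d^2 for some self-adjoint d, the limit of the iteration
   d |-> (b + d^2) / 2 started at 0. *)
Section AutomaticContinuity.
Variables (R : realType) (A : cstarAlgType R).

Lemma small_eq0 (x K : R) : 0 <= x ->
  (forall e, 0 < e -> x <= K * e) -> x = 0.
Proof.
move=> x0 xK; apply/eqP; rewrite eq_le x0 andbT leNgt; apply/negP => x1.
have K1 : 0 < `|K| + 1 by rewrite ltr_wpDl.
pose y := x / (2 * (`|K| + 1)).
have y0 : 0 < y by rewrite divr_gt0 // mulr_gt0.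
have yE : x = y * (2 * (`|K| + 1)) by rewrite divfK // gt_eqF // mulr_gt0.
by have := xK y y0; have := ler_norm K; have := normr_ge0 K; nra.
Qed.

Lemma geometric_cvg (u : nat -> A) :
  (forall n, rnorm (u n.+1 - u n) <= 2^-1 ^+ n) ->
  exists d, forall e : R, 0 < e -> exists n, rnorm (d - u n) < e /\
    rnorm (d - u n.+1) < e.
Proof.
move=> hu.
have tail n k : rnorm (u (n + k)%N - u n) <= 2 * 2^-1 ^+ n - 2 * 2^-1 ^+ (n + k).
  elim: k => [|k ih]; first by rewrite addn0 !subrr rnorm0.
  rewrite addnS; apply: (@le_trans _ _ (2^-1 ^+ (n + k) + (2 * 2^-1 ^+ n - 2 * 2^-1 ^+ (n + k)))).
    have -> : u (n + k).+1 - u n =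
        (u (n + k).+1 - u (n + k)%N) + (u (n + k)%N - u n).
      by rewrite addrA subrK.
    by apply: (le_trans (rnormD _ _)); apply: lerD.
  by rewrite exprS; lra.
have g0 : (fun n => 2 * 2^-1 ^+ n : R) @ \oo --> (0 : R).
  rewrite -[X in _ --> X](mulr0 2).
  apply: cvgMr; apply: cvg_expr.
  by rewrite ger0_norm ?invr_ge0 // invf_lt1 // ltr1n.
have small (e : R) : 0 < e -> \forall n \near \oo, 2 * 2^-1 ^+ n < e.
  move=> e0; have /cvgrPdist_lt/(_ e e0) := g0.
  by apply: filterS => n; rewrite sub0r normrN; apply: le_lt_trans; rewrite ler_norm.
have : cvg (u @ \oo).
  apply: cauchy_cvg; apply: cauchy_exP => e e0.
  have eE : (complex.Re e)%:C = e by rewrite RRe_real // gtr0_real.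
  have e1 : 0 < complex.Re e by rewrite -ltcR eE.
  have [N _ hN] := small _ e1.
  exists (u N); exists N => // m /= Nm.
  rewrite -ball_normE /= distrC rnormE -eE ltcR -(subnKC Nm).
  apply: (le_lt_trans (tail _ _)); apply: le_lt_trans (hN N (leqnn N)).
  by rewrite gerBl mulr_ge0 // exprn_ge0 // invr_ge0.
move=> /cvg_ex[d ud]; exists d => e e0.
have eC : 0 < e%:C by rewrite ltcR.
have /cvgrPdist_lt/(_ _ eC)[N _ hN] := ud.
by exists N; split; rewrite -ltcR -rnormE; apply: hN => /=.
Qed.

Lemma sqrt_iter (b : A) : cstar b = b -> rnorm b <= 4^-1 ->
  exists d, cstar d = d /\ 2 *: d = b + cmul d d.
Proof.
move=> bs b4.
pose F d := 2^-1 *: (b + cmul d d).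
pose u n := iter n F 0.
have n2 : complex.Re `|2^-1 : R[i]| = 2^-1 :> R.
  have -> : (2^-1 : R[i]) = (2^-1)%:C by rewrite fmorphV rmorph_nat.
  by rewrite ger0_norm // ler0c invr_ge0.
have us n : cstar (u n) = u n.
  elim: n => [|n ih] /=.
    by have := cstarZ 0 (0 : A); rewrite conjc0 !scale0r.
  rewrite /F cstarZ cstarD cstarM bs ih; congr (_ *: _).
  by rewrite conjc_inv conjc_nat.
have uh n : rnorm (u n) <= 2^-1.
  elim: n => [|n ih] /=; first by rewrite rnorm0 invr_ge0.
  rewrite /F rnormZ n2.
  have := rnormD b (cmul (u n) (u n)); have := rcnormM (u n) (u n).
  have : rnorm (u n) * rnorm (u n) <= 2^-1 * 2^-1.
    by rewrite ler_pM ?rnorm_ge0.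
  lra.
have cmulB (x y : A) : cmul x x - cmul y y = cmul x (x - y) + cmul (x - y) y.
  by rewrite linearBr linearBl addrA subrK.
have FB x y : rnorm (F x - F y) <= 2^-1 * ((rnorm x + rnorm y) * rnorm (x - y)).
  rewrite /F -scalerBr opprD addrACA subrr add0r cmulB rnormZ n2.
  rewrite ler_wpM2l ?invr_ge0 //; apply: (le_trans (rnormD _ _)).
  rewrite mulrDl lerD ?rcnormM // mulrC; exact: rcnormM.
have [n|d hd] := @geometric_cvg u.
  elim: n => [|n ih].
    have -> : u 1%N - u 0%N = u 1%N by rewrite subr0.
    by apply: (le_trans (uh _)); rewrite expr0; lra.
  apply: (le_trans (FB _ _)); rewrite exprS ler_wpM2l ?invr_ge0 //.
  apply: le_trans ih; rewrite ler_piMl ?rnorm_ge0 //.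
  have := uh n.+1; have := uh n; lra.
have dB x y : rnorm (x - y : A) = rnorm (y - x) by rewrite /rnorm distrC.
exists d; split; apply/eqP; rewrite -subr_eq0; apply/eqP/rnorm_eq0.
  apply: (@small_eq0 _ 2); first exact: rnorm_ge0.
  move=> e /hd[n [ne _]].
  have -> : cstar d - d = cstar (d - u n) + (u n - d).
    have -> : cstar (d - u n) = cstar d - u n.
      by rewrite cstarB us.
    by rewrite addrA subrK.
  apply: (le_trans (rnormD _ _)); rewrite rnorm_cstar (dB (u n)).
  lra.
suff d0 : d - F d = 0.
  have -> : 2 *: d = 2 *: F d by rewrite -[in LHS](subrK (F d) d) d0 add0r.
  by rewrite /F scalerA divff ?pnatr_eq0 // scale1r subrr rnorm0.
apply: rnorm_eq0; apply: (@small_eq0 _ (1 + 2^-1 * (rnorm d + 2^-1))).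
  exact: rnorm_ge0.
move=> e /hd[n [ne ne1]].
have -> : d - F d = (d - u n.+1) + (F (u n) - F d) by rewrite addrA subrK.
apply: (le_trans (rnormD _ _)); rewrite mulrDl mul1r.
apply: lerD; first exact: ltW.
apply: (le_trans (FB _ _)); rewrite -mulrA ler_wpM2l ?invr_ge0 //.
apply: ler_pM; rewrite ?rnorm_ge0 ?addr_ge0 ?rnorm_ge0 //.
  by rewrite addrC lerD2l.
by rewrite dB ltW.
Qed.

Variables (H : hilbertType R) (pi : star_rep A H).

Lemma rep_bounded a x : rnorm (pi a x) <= 2 * rnorm a * rnorm x.
Proof.
have small c y : rnorm c <= 2^-1 -> rnorm (pi c y) <= rnorm y.
  move=> c2; set b := cmul (cstar c) c.
  have bs : cstar b = b by rewrite /b cstarM cstarK.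
  have b4 : rnorm b <= 4^-1.
    rewrite /b rcnorm_star expr2.
    have : rnorm c * rnorm c <= 2^-1 * 2^-1 by rewrite ler_pM ?rnorm_ge0.
    lra.
  have [d [ds db]] := sqrt_iter bs b4.
  have piD : 2 *: pi d y = pi b y + pi d (pi d y).
    by rewrite -rep_mul -blinZE -linearZ /= db linearD.
  have dotcc : hdot (pi c y) (pi c y) = hdot (pi b y) y.
    by rewrite rep_mul rep_star.
  have dotdd : hdot (pi d y) (pi d y) = hdot (pi d (pi d y)) y.
    by have := rep_star pi d (pi d y) y; rewrite ds => ->.
  have dotd : hdot y (pi d y) = hdot (pi d y) y.
    by have := rep_star pi d y y; rewrite ds => ->.
  have E : (rnorm (y - pi d y) ^+ 2)%:C
      = (rnorm y ^+ 2)%:C - (rnorm (pi c y) ^+ 2)%:C.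
    rewrite -!rhdot_norm linearBl !linearBr /= dotd dotdd dotcc.
    have := congr1 (fun z => hdot z y) piD; rewrite linearZl_LR linearDl /= => h.
    have -> : hdot (pi b y) y = 2 * hdot (pi d y) y - hdot (pi d (pi d y)) y.
      by rewrite h addrK.
    by ring.
  move: E; rewrite -rmorphB => /complexI E.
  rewrite -(@ler_pXn2r _ 2) ?nnegrE ?rnorm_ge0 //.
  by rewrite -subr_ge0 -E sqr_ge0.
have [->|a0] := eqVneq a 0.
  by rewrite linear0 blin0E !rnorm0 mulr0 mul0r.
have na0 : 0 < rnorm a.
  by rewrite lt_def rnorm_ge0 andbT; apply: contra_neq a0; apply: rnorm_eq0.
pose t : R := (2 * rnorm a)^-1.
have t0 : 0 < t by rewrite invr_gt0 mulr_gt0.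
have nt : complex.Re `|t%:C| = t by rewrite ger0_norm // ler0c ltW.
have := small (t%:C *: a) x.
rewrite linearZ blinZE !rnormZ nt.
have -> : t * rnorm a = 2^-1 by rewrite /t; field; rewrite gt_eqF.
by move=> /(_ (lexx _)); rewrite ler_pdivrMl ?mulr_gt0.
Qed.

End AutomaticContinuity.

Definition dual (R : realType) (V : normedModType R[i]) := blin V R[i]^o.

Definition bidual (R : realType) (V : normedModType R[i]) := dual (dual V).

Section Duality.
Variables (R : realType) (V W : normedModType R[i]).

Let linear_eval (x : V) : linear (fun f : dual V => f x : R[i]^o).
Proof. by []. Qed.

Let bound_eval (x : V) (f : dual V) :
  rnorm (f x : R[i]^o) <= rnorm x * rnorm f.
Proof. by rewrite mulrC; exact: opnormP. Qed.

(* The canonical embedding of V into its bidual. *)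
Definition to_bidual (x : V) : bidual V :=
  Blin (bound_mem_blin (linear_eval x) (bound_eval x)).

Variable T : blin V W.

Let linear_comp (f : dual W) : linear (fun x => f (T x)).
Proof. by move=> c x y; rewrite !linearP. Qed.

Let bound_comp (f : dual W) x :
  rnorm (f (T x)) <= rnorm f * rnorm T * rnorm x.
Proof.
apply: (le_trans (opnormP f (T x))); rewrite -mulrA ler_wpM2l ?opnorm_ge0 //.
exact: opnormP.
Qed.

Let transpose_fun (f : dual W) : dual V :=
  Blin (bound_mem_blin (linear_comp f) (bound_comp f)).

Let linear_transpose : linear transpose_fun.
Proof. by move=> c f g; apply/blinP. Qed.

Let bound_transpose (f : dual W) :
  rnorm (transpose_fun f) <= rnorm T * rnorm f.
Proof.
apply: opnorm_le => x x1; apply: (le_trans (bound_comp f x)).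
by rewrite (mulrC (rnorm T)) ler_piMr // mulr_ge0 ?rnorm_ge0.
Qed.

Definition transpose : blin (dual W) (dual V) :=
  Blin (bound_mem_blin linear_transpose bound_transpose).

End Duality.

Definition bitranspose (R : realType) (V W : normedModType R[i])
    (T : blin V W) : blin (bidual V) (bidual W) :=
  transpose (transpose T).

Section BidualAlgebra.
Variables (R : realType) (A : cstarAlgType R).
Implicit Types (a b : A) (f g : dual A) (X Y Z : bidual A).

Let linear_act f a : linear (fun b => f (cmul a b)).
Proof. by move=> c x y; rewrite linearPr linearP. Qed.

Let bound_act f a b : rnorm (f (cmul a b)) <= rnorm f * rnorm a * rnorm b.
Proof.
apply: (le_trans (opnormP f _)); rewrite -mulrA ler_wpM2l ?opnorm_ge0 //.
exact: rcnormM.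
Qed.

(* b |-> f (a b) *)
Definition dual_act f a : dual A :=
  Blin (bound_mem_blin (linear_act f a) (bound_act f a)).

Let rnorm_act f a : rnorm (dual_act f a) <= rnorm f * rnorm a.
Proof.
apply: opnorm_le => b b1; apply: (le_trans (bound_act f a b)).
by rewrite ler_piMr // mulr_ge0 ?rnorm_ge0.
Qed.

Let linear_bidual_act X f : linear (fun a => X (dual_act f a)).
Proof.
move=> c a b; rewrite -linearP; congr (blin_fun X _); apply/blinP => x.
by rewrite /= linearPl linearP.
Qed.

Let bound_bidual_act X f a :
  rnorm (X (dual_act f a)) <= rnorm X * rnorm f * rnorm a.
Proof.
apply: (le_trans (opnormP X _)).
by rewrite -mulrA ler_wpM2l ?opnorm_ge0.
Qed.

(* a |-> X (b |-> f (a b)) *)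
Definition bidual_act X f : dual A :=
  Blin (bound_mem_blin (linear_bidual_act X f) (bound_bidual_act X f)).

Let linear_bimul X Y : linear (fun f => X (bidual_act Y f)).
Proof.
move=> c f g; rewrite -linearP; congr (blin_fun X _); apply/blinP => a.
by apply: etrans (linearP Y c _ _); congr (blin_fun Y _); apply/blinP.
Qed.

Let bound_bimul X Y f : rnorm (X (bidual_act Y f)) <= rnorm X * rnorm Y * rnorm f.
Proof.
apply: (le_trans (opnormP X _)); rewrite -mulrA ler_wpM2l ?opnorm_ge0 //.
apply: opnorm_le => a a1; apply: (le_trans (bound_bidual_act Y f a)).
by rewrite ler_piMr // mulr_ge0 ?rnorm_ge0.
Qed.

(* The (first) Arens product. *)
Definition bimul X Y : bidual A :=
  Blin (bound_mem_blin (linear_bimul X Y) (bound_bimul X Y)).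

Let linear_dual_star f : linear (fun a => (f (cstar a))^*%C : R[i]^o).
Proof.
move=> c a b; rewrite cstarD cstarZ linearP /= rmorphD rmorphM /=.
by rewrite conjcK.
Qed.

Let rnorm_conjc (z : R[i]) : rnorm (z^*%C : R[i]^o) = rnorm (z : R[i]^o).
Proof. by case: z => x y; rewrite /rnorm /= sqrrN. Qed.

Let bound_dual_star f a :
  rnorm ((f (cstar a))^*%C : R[i]^o) <= rnorm f * rnorm a.
Proof. by rewrite rnorm_conjc -(rnorm_cstar a); exact: opnormP. Qed.

Definition dual_star f : dual A :=
  Blin (bound_mem_blin (linear_dual_star f) (bound_dual_star f)).

Let linear_bistar X : linear (fun f => (X (dual_star f))^*%C : R[i]^o).
Proof.
move=> c f g.
have -> : dual_star (c *: f + g) = c^*%C *: dual_star f + dual_star g.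
  by apply/blinP => a; rewrite /= rmorphD rmorphM.
rewrite linearP /= rmorphD rmorphM /=.
by rewrite conjcK.
Qed.

Let bound_bistar X f :
  rnorm ((X (dual_star f))^*%C : R[i]^o) <= rnorm X * rnorm f.
Proof.
rewrite rnorm_conjc; apply: (le_trans (opnormP X _)).
rewrite ler_wpM2l ?opnorm_ge0 //; apply: opnorm_le => a a1.
apply: (le_trans (bound_dual_star f a)).
by rewrite ler_piMr // rnorm_ge0.
Qed.

(* The extension of the involution of A that is weak-* continuous. *)
Definition bistar X : bidual A :=
  Blin (bound_mem_blin (linear_bistar X) (bound_bistar X)).

Definition bidual_unit X := forall Y, bimul X Y = Y /\ bimul Y X = Y.

Definition central_projection X :=
  [/\ bimul X X = X, bistar X = X & forall Y, bimul X Y = bimul Y X].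

Lemma bimulA : associative bimul.
Proof.
move=> X Y Z; apply/blinP => f /=; congr (blin_fun X _); apply/blinP => a /=.
congr (blin_fun Y _); apply/blinP => b /=; congr (blin_fun Z _).
by apply/blinP => c /=; rewrite cmulA.
Qed.

Lemma to_bidualM a b : to_bidual (cmul a b) = bimul (to_bidual a) (to_bidual b).
Proof. exact/blinP. Qed.

Lemma to_bidual_cstar a : to_bidual (cstar a) = bistar (to_bidual a).
Proof. by apply/blinP => f /=; rewrite conjcK. Qed.

End BidualAlgebra.

Section Representations.
Variables (R : realType) (A : cstarAlgType R).

Section Rep.
Variables (H : hilbertType R) (pi : star_rep A H).

Let bound_rep a : rnorm (pi a) <= 2 * rnorm a.
Proof.
apply: opnorm_le => x x1; apply: (le_trans (rep_bounded pi a x)).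
by rewrite ler_piMr // mulr_ge0 ?rnorm_ge0.
Qed.

Definition rep_blin : blin A (blin H H) :=
  Blin (bound_mem_blin (@linearP _ _ _ _ pi) bound_rep).

(* pi^** : A^** -> B(H)^** *)
Definition rep_bidual : blin (bidual A) (bidual (blin H H)) :=
  bitranspose rep_blin.

(* [e] is the central projection with e A^** = ker pi^**. *)
Definition kernel_projection (e : bidual A) :=
  central_projection e /\
  [set bimul e X | X in setT] = [set X | rep_bidual X = 0].

(* [s] is I - e_pi, where I is the unit of A^**. *)
Definition support_projection (s : bidual A) :=
  exists I e : bidual A,
    [/\ bidual_unit I, kernel_projection e & s = I - e].

Lemma kernel_projection_unique e e' :
  kernel_projection e -> kernel_projection e' -> e = e'.
Proof.
have le u v : kernel_projection u -> kernel_projection v -> bimul v u = u.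
  move=> [[uu _ _] uE] [[vv _ _] vE].
  have : [set bimul u X | X in setT] u by exists u.
  by rewrite uE -vE => -[X _ <-]; rewrite bimulA vv.
move=> he he'; rewrite -(le e e') // -[RHS](le e' e) //.
by case: he' => -[_ _ ->].
Qed.

Lemma support_projection_unique s s' :
  support_projection s -> support_projection s' -> s = s'.
Proof.
move=> [I [e [I1 he ->]]] [I' [e' [I1' he' ->]]].
rewrite (kernel_projection_unique he he').
by have [<- _] := I1 I'; have [_ ->] := I1' I.
Qed.

(* Irreducible representations are nonzero. *)
Definition irreducible_rep :=
  (exists a x, pi a x != 0) /\
  forall K : set H, closed K -> K 0 ->
    (forall (c : R[i]) x y, K x -> K y -> K (c *: x + y)) ->
    (forall a x, K x -> K (pi a x)) ->
    K = [set 0] \/ K = setT.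

End Rep.

Definition unitarily_equivalent (H1 H2 : hilbertType R)
    (pi1 : star_rep A H1) (pi2 : star_rep A H2) :=
  exists U : {linear H1 -> H2},
    [/\ forall x y, hdot (U x) (U y) = hdot x y,
        forall y, exists x, U x = y &
        forall a x, U (pi1 a x) = pi2 a (U x)].

End Representations.

Definition finite_dimensional (R : realType) (H : hilbertType R) :=
  exists n (b : 'I_n -> H),
    forall x, exists c : 'I_n -> R[i], x = \sum_(i < n) c i *: b i.

(* The norm of the Hilbert space direct sum H^n. *)
Definition l2norm (R : realType) (H : hilbertType R) n (x : 'I_n -> H) : R :=
  Num.sqrt (\sum_(i < n) rnorm (x i) ^+ 2).

(* The norm of M_n(B(H)) = B(H^n). *)
Definition mxopnorm (R : realType) (H : hilbertType R) n
    (X : 'M[blin H H]_n) : R :=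
  sup [set l2norm (fun i => \sum_(j < n) X i j (x j))
      | x in [set x : 'I_n -> H | l2norm x <= 1]].

(* The supremum is taken in [0, +oo]: it is 0 over the empty family. *)
Definition peaks_strongly (R : realType) (A : cstarAlgType R) n (T : 'M[A]_n)
    (H : hilbertType R) (pi : star_rep A H) : Prop :=
  (ereal_sup [set r | r = 0%E \/
    exists (K : hilbertType R) (sigma : star_rep A K),
      [/\ irreducible_rep sigma, ~ unitarily_equivalent sigma pi &
          r = (mxopnorm (map_mx sigma T))%:E]]
  < (mxopnorm (map_mx pi T))%:E)%E.

(* Main.v *)
Require Import Defs.
From HB Require Import structures.
From mathcomp Require Import all_boot all_order all_algebra complex ring.
From mathcomp Require Import all_classical all_reals all_analysis.

Set Implicit Arguments.
Unset Strict Implicit.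
Unset Printing Implicit Defensive.

Import Order.TTheory GRing.Theory Num.Theory.
Import numFieldNormedType.Exports.

Local Open Scope classical_set_scope.
Local Open Scope complex_scope.
Local Open Scope ring_scope.

(** Write [I - e] for the support projection [s] of [pi], where the central
    projection [e] of the bidual satisfies [e A^** = ker pi^**].  Two facts
    about [s] follow by computing in the bidual and evaluating at matrix
    coefficients of representations.
    - [pi (s a) = pi a] for all [a], because [s a - a = - e a] lies in
      [ker pi^**] ([support_unit]).  As [pi] is nonzero, [pi s <> 0].
    - If [pi a = 0] then [a = e X] for some [X], hence [s a = (I - e) e X = 0]
      ([support_kernel]).

    It remains to see that [sigma s = 0] for every irreducible [sigma] on [K]
    that is not equivalent to [pi] ([support_vanishes]); the supremum in the definition
    of a strong peak is then 0.  The vectors of [K] killed by [sigma (ker pi)]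
    form a closed invariant subspace, which is 0 or [K].  If it is 0, then
    [sigma s = 0], because [sigma a] kills the range of [sigma s^*] for every
    [a] in [ker pi]: this is the adjoint of [s a^* = 0].  If it is [K], then
    [ker pi] is contained in [ker sigma], and the claim is that [sigma] is
    equivalent to [pi] ([kernel_le_equivalent]).

    For that claim fix [k] in [K] with [sigma A k <> 0].  Finitely many vectors
    of [H] have the property that an [a] annihilating all of them satisfies
    [sigma a k = 0].  Peeling them off one at a time yields a left ideal [L]
    and a single vector [y] such that [pi a y |-> sigma a k] is a well defined
    nonzero map on [L y] ([annihilator_peeling]).  Irreducibility of [pi] makes
    it an intertwiner [V] defined on all of [H], and irreducibility of [sigma]
    makes it surjective.  Finally, Schur's lemma for [V^* V], whose eigenvalue
    comes from the Cayley-Hamilton theorem, says that [V] is a multiple of a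
    unitary ([intertwiner_unitary]).

    Irreducibility speaks of closed subspaces only, so subspaces of finite
    spans have to be shown closed; they are, since they admit orthogonal
    projections ([finite_orthogonal_projection]). *)

(** * Eigenvectors of endomorphisms of a finitely spanned space *)

Section Eigenvector.
Variables (F : closedFieldType) (V : lmodType F).

(** The family [b] need not be free: a matrix [M] of [T] with respect to [b]
    acts on coordinate vectors, and [L] pushes this action down to [V].  By
    Cayley-Hamilton a product of factors [M - z] kills all coordinates; the
    last vector of [V] that survives multiplication by these factors one after
    the other is an eigenvector. *)
Lemma finite_span_eigenvector n (b : 'I_n -> V) (T : V -> V) (x0 : V) :
    (forall x, exists c : 'I_n -> F, x = \sum_(i < n) c i *: b i) ->
    linear T -> x0 != 0 ->
  exists l x, x != 0 /\ T x = l *: x.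
Proof.
case: n b => [|n] b spanb linT x0n0.
  by have [c] := spanb x0; rewrite big_ord0 => /eqP; rewrite (negPf x0n0).
pose TL : {linear V -> V} := HB.pack T (GRing.isLinear.Build _ _ _ _ _ linT).
have TE x : T x = TL x by [].
pose L (v : 'rV[F]_n.+1) := \sum_(i < n.+1) v 0 i *: b i.
have linL : linear L.
  move=> c u v; rewrite /L scaler_sumr -big_split /=; apply: eq_bigr => i _.
  by rewrite !mxE scalerA scalerDl.
pose LL : {linear 'rV[F]_n.+1 -> V} :=
  HB.pack L (GRing.isLinear.Build _ _ _ _ _ linL).
have LE v : L v = LL v by [].
have /choice[m mP] := fun i => spanb (T (b i)).
pose M := \matrix_(i, j) m i j.
have LM v : L (v *m M) = T (L v).
  rewrite TE linear_sum /L; under [RHS]eq_bigr => i _.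
    rewrite linearZ /= mP scaler_sumr.
    over.
  rewrite exchange_big; apply: eq_bigr => j _ /=.
  rewrite mxE scaler_suml; apply: eq_bigr => i _.
  by rewrite mxE scalerA.
have [c0 x0E] := spanb x0.
have [r rE] := closed_field_poly_normal (char_poly M).
move: rE; rewrite (monicP (char_poly_monic M)) scale1r => rE.
have := Cayley_Hamilton M; rewrite {}rE => CH.
have : L ((\row_i c0 i) *m horner_mx M (\prod_(z <- r) ('X - z%:P))) = 0.
  by rewrite CH mulmx0 LE linear0.
have : L (\row_i c0 i) != 0.
  by rewrite /L; under eq_bigr => i _ do rewrite mxE; rewrite -x0E.
elim: r (\row_i c0 i) {CH} => [|z r ih] v vn0.
  by rewrite big_nil rmorph1 mulmx1 => v0; rewrite v0 eqxx in vn0.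
have mE : horner_mx M ('X - z%:P) = M - z%:M.
  by rewrite rmorphB /= horner_mx_X horner_mx_C.
rewrite big_cons rmorphM /= mulmxA => h.
have [w0|wn0] := eqVneq (L (v *m horner_mx M ('X - z%:P))) 0; last exact: ih h.
exists z, (L v); split => //; move: w0.
rewrite mE mulmxBr mul_mx_scalar LE linearB linearZ /= LM.
by move/eqP; rewrite subr_eq0 => /eqP.
Qed.

End Eigenvector.

(** * Finite-dimensional subspaces of a Hilbert space *)

Section BlinKernel.
Variables (R : realType) (V W : normedModType R[i]).

Lemma rnorm_gt0 (x : V) : x != 0 -> 0 < rnorm x.
Proof.
move=> x0; rewrite lt_def rnorm_ge0 andbT.
by apply: contra_neq x0; apply: rnorm_eq0.
Qed.

Lemma blin_kernel_closed (T : blin V W) : closed (T @^-1` [set 0]).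
Proof.
apply: preimage_closed; first by move=> x _; exact: blin_continuous.
exact/accessible_closed_set1/hausdorff_accessible/norm_hausdorff.
Qed.

End BlinKernel.

Section Subspaces.
Variables (R : realType) (H : hilbertType R).
Implicit Types (x y z : H) (M : set H).

Lemma hdotDl x y z : hdot (x + y) z = hdot x z + hdot y z.
Proof. exact: linearDl. Qed.
Lemma hdotBl x y z : hdot (x - y) z = hdot x z - hdot y z.
Proof. exact: linearBl. Qed.
Lemma hdotZl c x z : hdot (c *: x) z = c * hdot x z.
Proof. exact: linearZl_LR. Qed.
Lemma hdotDr x y z : hdot z (x + y) = hdot z x + hdot z y.
Proof. exact: linearDr. Qed.
Lemma hdotBr x y z : hdot z (x - y) = hdot z x - hdot z y.
Proof. exact: linearBr. Qed.
Lemma hdotZr c x z : hdot z (c *: x) = c^*%C * hdot z x.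
Proof. by rewrite hdot_sym hdotZl rmorphM /= -hdot_sym. Qed.
Lemma hdot0r x : hdot x 0 = 0.
Proof. exact: linear0r. Qed.
Lemma hdotC0 x y : hdot x y = 0 -> hdot y x = 0.
Proof. by rewrite hdot_sym => h; rewrite hdot_sym hdot_sym h conjc0. Qed.

Lemma hdot_eq0 x : hdot x x = 0 -> x = 0.
Proof. by rewrite hdot_norm => /eqP; rewrite sqrf_eq0 normr_eq0 => /eqP. Qed.

Lemma hdot_inj x y : (forall z, hdot z x = hdot z y) -> x = y.
Proof.
move=> xy; apply/eqP; rewrite -subr_eq0; apply/eqP/hdot_eq0.
by rewrite hdotBr xy subrr.
Qed.

(** The Cauchy-Schwarz inequality, from the square norm of
    [z = <y, y> x - <x, y> y]. *)
Lemma hdot_bound x y : rnorm (hdot x y : R[i]^o) <= rnorm y * rnorm x.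
Proof.
have [->|y0] := eqVneq y 0; first by rewrite hdot0r !rnorm0 mul0r.
have ny0 := rnorm_gt0 y0.
pose z := (hdot y y) *: x - hdot x y *: y.
have E : hdot z z = hdot y y * (hdot x x * hdot y y - `|hdot x y| ^+ 2).
  rewrite /z hdotBl !hdotBr !hdotZl !hdotZr normCK -(hdot_sym y y).
  rewrite -[(hdot x y)^*]/((hdot x y)^*%C) -(hdot_sym y x).
  by ring.
move: E; rewrite (rnormE (hdot x y : R[i]^o)) !rhdot_norm.
rewrite -!(rmorphXn, rmorphM, rmorphB) /=.
move=> /complexI E.
have : 0 <= rnorm x ^+ 2 * rnorm y ^+ 2 - rnorm (hdot x y : R[i]^o) ^+ 2.
  by rewrite -(pmulr_rge0 _ (exprn_gt0 2 ny0)) -E sqr_ge0.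
rewrite subr_ge0 -exprMn mulrC ler_pXn2r ?nnegrE ?mulr_ge0 ?rnorm_ge0 //.
Qed.

Definition hdot_functional y : dual H :=
  Blin (bound_mem_blin (@hdot_linear R H y) (fun x => hdot_bound x y)).

Definition subspace M :=
  M 0 /\ forall (c : R[i]) x y, M x -> M y -> M (c *: x + y).

(** Gram-Schmidt, run on the spanning family of an ambient space rather than on
    one of [M]: dropping the last vector of [b] cuts [M] down to a subspace
    [M'] of codimension at most 1, and a vector [m] of [M] outside [M'] minus
    its projection onto [M'] supplies the missing direction. *)
Lemma finite_orthogonal_projection n (b : 'I_n -> H) M : subspace M ->
    (forall x, M x -> exists c : 'I_n -> R[i], x = \sum_(i < n) c i *: b i) ->
  forall x, exists2 p, M p & forall y, M y -> hdot (x - p) y = 0.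
Proof.
elim: n b M => [|n ih] b M [M0 ML] spanM x.
  by exists 0 => // y /spanM[c]; rewrite big_ord0 => ->; rewrite hdot0r.
pose b' i := b (widen_ord (leqnSn n) i).
pose M' :=
  M `&` [set z | exists c : 'I_n -> R[i], z = \sum_(i < n) c i *: b' i].
have M'sub : subspace M'.
  split.
    split => //; exists (fun _ => 0).
    by rewrite big1 // => i _; rewrite scale0r.
  move=> a u v [Mu [c uE]] [Mv [d vE]]; split; first exact: ML.
  exists (fun i => a * c i + d i); rewrite uE vE scaler_sumr -big_split /=.
  by apply: eq_bigr => i _; rewrite scalerDl scalerA.
have {}ih := ih b' M' M'sub (fun z (M'z : M' z) => M'z.2).
have [[m [Mm M'm]]|allM'] := pselect (exists m, M m /\ ~ M' m); last first.
  have [p [Mp _] pP] := ih x; exists p => // y My; apply: pP.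
  by apply: contrapT => nM'; apply: allM'; exists y.
have [q M'q qP] := ih m; have [p M'p pP] := ih x.
have Mq : M q by case: M'q.
have Mp : M p by case: M'p.
have [d dE] : exists d, d = m - q by exists (m - q).
rewrite -dE in qP; have Md : M d.
  by rewrite dE addrC -scaleN1r; apply: ML.
have dn0 : hdot d d != 0.
  apply/eqP => /hdot_eq0 /eqP; rewrite dE subr_eq0 => /eqP mq.
  by apply: M'm; rewrite mq.
exists (hdot x d / hdot d d *: d + p); first exact: ML.
move=> y My.
have [t [y' M'y' yE]] : exists t, exists2 y', M' y' & y = t *: d + y'.
  have [cm mE] := spanM m Mm; have [cy yE] := spanM y My.
  have cmn0 : cm ord_max != 0.
    apply/eqP => cm0; apply: M'm; split => //.
    exists (fun i => cm (widen_ord (leqnSn n) i)).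
    by rewrite {1}mE big_ord_recr /= cm0 scale0r addr0.
  pose t := cy ord_max / cm ord_max; exists t, (y - t *: d).
    2: by rewrite addrC subrK.
  have -> : y - t *: d = t *: q + (- t *: m + y).
    by rewrite dE scalerBr scaleNr opprB addrCA [y - _]addrC.
  apply: M'sub.2 => //; split; first exact: ML.
  exists (fun i =>
    cy (widen_ord (leqnSn n) i) - t * cm (widen_ord (leqnSn n) i)).
  rewrite {1}mE {1}yE !big_ord_recr /= scalerDr scalerA mulNr divfK // addrACA.
  rewrite -scalerDl addNr scale0r addr0 scaler_sumr -big_split /=.
  by apply: eq_bigr => i _; rewrite scalerA mulNr -scalerDl addrC.
have xd : hdot (x - (hdot x d / hdot d d *: d + p)) d = 0.
  rewrite opprD addrA !hdotBl hdotZl divfK // subrr sub0r hdotC0 ?oppr0 //.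
  exact: qP.
have xy' : hdot (x - (hdot x d / hdot d d *: d + p)) y' = 0.
  by rewrite opprD addrCA hdotDl pP // addr0 -scaleNr hdotZl (qP y') ?mulr0.
by rewrite yE hdotDr hdotZr xd xy' mulr0 addr0.
Qed.

(** A subspace with orthogonal projections equals its double orthogonal
    complement, which is an intersection of kernels of continuous
    functionals. *)
Lemma finite_subspace_closed n (b : 'I_n -> H) M : subspace M ->
    (forall x, M x -> exists c : 'I_n -> R[i], x = \sum_(i < n) c i *: b i) ->
  closed M.
Proof.
move=> Msub spanM.
have -> : M = \bigcap_(z in [set z | forall y, M y -> hdot y z = 0])
    (hdot_functional z @^-1` [set 0]).
  apply/seteqP; split=> [x Mx z /= zP|x xP]; first exact: zP.
  have [p Mp pP] := finite_orthogonal_projection Msub spanM x.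
  have pP' y : M y -> hdot y (x - p) = 0 by move=> /pP /hdotC0.
  have /= xp := xP _ pP'.
  suff -> : x = p by [].
  apply/eqP; rewrite -subr_eq0; apply/eqP/hdot_eq0.
  by rewrite hdotBl xp (pP' p) // subrr.
by apply: closed_bigI => z _; exact: blin_kernel_closed.
Qed.

Hypothesis H_fin : finite_dimensional H.

(** The representing vector is a multiple of the component [w] of some [x0]
    orthogonal to the kernel of [phi]. *)
Lemma finite_riesz (phi : H -> R[i]) : scalar phi ->
  exists z, forall x, phi x = hdot x z.
Proof.
move=> phil.
pose phiL : {scalar H} := HB.pack phi (GRing.isLinear.Build _ _ _ _ _ phil).
have phiE x : phi x = phiL x by [].
have [[x0 x00]|phi0] := pselect (exists x, phi x != 0); last first.
  exists 0 => x; rewrite hdot0r; apply/eqP/negPn/negP => px; apply: phi0.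
  by exists x.
pose M := [set x | phi x = 0].
have Msub : subspace M.
  split; first by rewrite /M /= phiE linear0.
  by move=> c x y /= xM yM; rewrite /M /= phil xM yM mulr0 addr0.
have [n [b spanb]] := H_fin.
have [p Mp pP] := finite_orthogonal_projection Msub (fun x _ => spanb x) x0.
set w := x0 - p in pP.
have pw : phi w != 0 by rewrite phiE linearB /= (Mp : phi p = 0) subr0.
have wn0 : hdot w w != 0.
  by apply: contra_neq pw => /hdot_eq0 ->; rewrite phiE linear0.
exists ((phi w / hdot w w)^*%C *: w) => x; rewrite hdotZr conjcK.
have : M (x - phi x / phi w *: w).
  by rewrite /M /= phiE linearB linearZ /= divfK // subrr.
move=> /pP /hdotC0; rewrite hdotBl hdotZl => /eqP; rewrite subr_eq0 => /eqP ->.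
by field; rewrite wn0 pw.
Qed.

End Subspaces.

(** * Intertwiners with a finite-dimensional irreducible representation *)

Section Intertwiners.
Variables (R : realType) (A : cstarAlgType R) (H K : hilbertType R).
Variables (pi : star_rep A H) (sigma : star_rep A K).
Hypothesis H_fin : finite_dimensional H.
Hypothesis pi_irr : irreducible_rep pi.
Hypothesis sigma_irr : irreducible_rep sigma.

Lemma rep_starr (L : hilbertType R) (rho : star_rep A L) a x y :
  hdot (rho a x) y = hdot x (rho (cstar a) y).
Proof. by rewrite -rep_star cstarK. Qed.

Lemma rep_linear (L : hilbertType R) (rho : star_rep A L) c a b x :
  rho (c *: a + b) x = c *: rho a x + rho b x.
Proof. by rewrite linearP. Qed.

Lemma finite_irreducible_subspace M x0 :
    subspace M -> (forall a x, M x -> M (pi a x)) -> M x0 -> x0 != 0 ->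
  forall x, M x.
Proof.
move=> Msub Minv Mx0 x0n0.
have [n [b spanb]] := H_fin.
have Mcl := finite_subspace_closed Msub (fun x _ => spanb x).
have [M0|->//] := pi_irr.2 M Mcl Msub.1 Msub.2 Minv.
by move: Mx0 x0n0; rewrite M0 /= => ->; rewrite eqxx.
Qed.

(** Schur's lemma.  The operator [T = V^* V] commutes with [pi], so that each
    of its eigenspaces is invariant, hence all of [H].  Thus [V] multiplies all
    inner products by one number, [t ^ 2], and [t] times the inverse of [V] is
    unitary. *)
Lemma intertwiner_unitary (V : H -> K) : linear V ->
    (forall k, exists h, V h = k) ->
    (forall a x, V (pi a x) = sigma a (V x)) ->
  unitarily_equivalent sigma pi.
Proof.
move=> linV surjV intV.
pose VL : {linear H -> K} := HB.pack V (GRing.isLinear.Build _ _ _ _ _ linV).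
have VE x : V x = VL x by [].
have [a0 [k0 k0n0]] := sigma_irr.1.
have [x0 x0E] := surjV (sigma a0 k0); rewrite -x0E in k0n0.
have x0n0 : x0 != 0 by apply: contra_neq k0n0 => ->; rewrite VE linear0.
have /choice[T TP] : forall y, exists z, forall x, hdot (V x) (V y) = hdot x z.
  move=> y; apply: (finite_riesz H_fin (phi := fun x => hdot (V x) (V y))).
  by move=> c u v; rewrite linV hdotDl hdotZl.
have linT : linear T.
  move=> c u v; apply: hdot_inj => x.
  by rewrite -TP linV !hdotDr !hdotZr !TP.
have [n [b spanb]] := H_fin.
have [l [x1 [x1n0 Tx1]]] := finite_span_eigenvector spanb linT x0n0.
have Tl x : T x = l *: x.
  apply: (@finite_irreducible_subspace [set x | T x = l *: x] x1) => //.
    split=> [|c u v /= Tu Tv].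
      by apply: hdot_inj => y; rewrite -TP (VE 0) linear0 scaler0 !hdot0r.
    by rewrite linT Tu Tv scalerDr !scalerA mulrC.
  move=> a u /= Tu; apply: hdot_inj => y.
  rewrite -TP intV -rep_star -intV TP Tu !hdotZr.
  by rewrite rep_star.
have dotV x y : hdot (V x) (V y) = l^*%C * hdot x y by rewrite TP Tl hdotZr.
have Vx0 := rnorm_gt0 k0n0; have nx0 := rnorm_gt0 x0n0.
(* Evaluating at [x0] identifies the eigenvalue as a positive real number and
   exhibits a square root of it. *)
pose t : R := rnorm (V x0) / rnorm x0.
have lE : l^*%C = (t ^+ 2)%:C.
  have := dotV x0 x0; rewrite !rhdot_norm => h.
  have xC : (rnorm x0 ^+ 2)%:C != 0 :> R[i].
    by rewrite fmorph_eq0 expf_neq0 // gt_eqF.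
  by apply: (mulIf xC); rewrite -h -rmorphM /= /t; congr (_%:C); field;
    rewrite gt_eqF.
have tn0 : (t ^+ 2)%:C != 0 :> R[i].
  by rewrite fmorph_eq0 expf_neq0 // gt_eqF // divr_gt0.
rewrite lE {l lE Tx1 Tl} in dotV *.
have injV x y : V x = V y -> x = y.
  move=> /eqP; rewrite -subr_eq0 !VE -linearB /= => /eqP Vxy.
  apply/eqP; rewrite -subr_eq0; apply/eqP/hdot_eq0.
  by apply: (mulfI tn0); rewrite -dotV Vxy hdot0r mulr0.
have /choice[W WP] := surjV.
pose U k := t%:C *: W k.
have linU : linear U.
  move=> c u v; rewrite /U scalerA mulrC -scalerA -scalerDr; congr (_ *: _).
  by apply: injV; rewrite linV !WP.
pose UL : {linear K -> H} := HB.pack U (GRing.isLinear.Build _ _ _ _ _ linU).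
exists UL; split=> /=.
- move=> x y; rewrite /U hdotZl hdotZr mulrA.
  rewrite -[in RHS](WP x) -[in RHS](WP y) dotV.
  by congr (_ * _); rewrite conjc_real -rmorphM.
- move=> y; exists (V (t^-1%:C *: y)); rewrite /U.
  have -> : W (V (t^-1%:C *: y)) = t^-1%:C *: y by apply: injV; rewrite WP.
  by rewrite scalerA -rmorphM divff ?scale1r // gt_eqF // divr_gt0.
- move=> a x; rewrite /U linearZ /=; congr (_ *: _).
  by apply: injV; rewrite WP intV WP.
Qed.

Definition left_ideal (L : set A) :=
  [/\ L 0, forall (c : R[i]) a b, L a -> L b -> L (c *: a + b) &
      forall a b, L b -> L (cmul a b)].

(** Either some [a] in [L] kills the first vector [y] but not [k], and then one
    may replace [L] by the annihilator of [y] in [L] and drop [y]; or no such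
    [a] exists, and then [L] and [y] are as wanted.  The list cannot run
    out, since some element of [L] does not kill [k]. *)
Lemma annihilator_peeling (ys : seq H) (L : set A) k :
    left_ideal L -> (exists2 a, L a & sigma a k != 0) ->
    (forall a, L a -> (forall y, y \in ys -> pi a y = 0) -> sigma a k = 0) ->
  exists (L' : set A) y, [/\ left_ideal L', exists2 a, L' a & sigma a k != 0 &
    forall a, L' a -> pi a y = 0 -> sigma a k = 0].
Proof.
elim: ys L => [|y ys ih] L Lid [a0 La0 a0k] Lk.
  by move: a0k; rewrite Lk ?eqxx.
have [[a1 [La1 a1y a1k]]|noa1] :=
    pselect (exists a, [/\ L a, pi a y = 0 & sigma a k != 0]).
  apply: (ih (L `&` [set a | pi a y = 0])).
  - have [L0 Lc LM] := Lid; split.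
    + by split=> //=; rewrite linear0.
    + move=> c a b [La ay] [Lb yb]; split=> /=; first exact: Lc.
      by rewrite rep_linear (ay : pi a y = 0) (yb : pi b y = 0)
        scaler0 addr0.
    + move=> a b [Lb yb]; split=> /=; first exact: LM.
      by rewrite rep_mul (yb : pi b y = 0) linear0.
  - by exists a1.
  - move=> a [La ay] ays; apply: Lk => // z; rewrite inE => /orP[/eqP ->//|].
    exact: ays.
exists L, y; split=> //; first by exists a0.
move=> a La ay; apply/eqP/negPn/negP => ak; apply: noa1; by exists a.
Qed.

(** With [L] and [y] obtained by peeling off a spanning family of [H], the
    intertwiner is [pi a y |-> sigma a k] for [a] in [L].  It is defined on all
    of [H] because [pi L y] is a nonzero invariant subspace, and onto because
    its range is a nonzero invariant subspace of [K], closed as it lies in the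
    span of finitely many vectors. *)
Lemma kernel_le_equivalent : (forall a, pi a = 0 -> sigma a = 0) ->
  unitarily_equivalent sigma pi.
Proof.
move=> ker_le.
have [a0 [k a0k]] := sigma_irr.1.
have [n [b spanb]] := H_fin.
have [||a _ ab|L [y [[L0 LP LM] [a1 La1 a1k] Ly]]] :=
    @annihilator_peeling [seq b i | i <- enum 'I_n] setT k.
- by split.
- by exists a0.
- rewrite ker_le ?blin0E //; apply/blinP => x; have [c ->] := spanb x.
  rewrite linear_sum big1 // => i _; rewrite linearZ /= ab ?scaler0 //.
  by rewrite map_f // mem_enum.
have onto : forall x, exists2 a, L a & pi a y = x.
  apply: (@finite_irreducible_subspace [set x | exists2 a, L a & pi a y = x]
    (pi a1 y)).
  - split=> [|c u v [a La <-] [d Ld <-]]; first by exists 0; rewrite ?linear0.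
    by exists (c *: a + d); [exact: LP|exact: rep_linear].
  - move=> a u [d Ld <-]; exists (cmul a d); [exact: LM|exact: rep_mul].
  - by exists a1.
  - by apply: contra_neq a1k; apply: Ly.
have /choice[w wP] : forall x, exists a, L a /\ pi a y = x.
  by move=> x; have [a La ax] := onto x; exists a.
have wk a : L a -> sigma (w (pi a y)) k = sigma a k.
  move=> La; have [Lw wE] := wP (pi a y).
  apply/eqP; rewrite -subr_eq0; apply/eqP.
  have := Ly _ (LP (-1) _ _ La Lw).
  rewrite !rep_linear !scaleN1r wE addNr addrC.
  exact.
pose V x := sigma (w x) k.
have linV : linear V.
  move=> c u v; rewrite /V.
  have [Lu uE] := wP u; have [Lv vE] := wP v.
  have -> : c *: u + v = pi (c *: w u + w v) y.
    by rewrite rep_linear uE vE.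
  by rewrite wk ?rep_linear //; exact: LP.
have intV a x : V (pi a x) = sigma a (V x).
  rewrite /V; have [Lx xE] := wP x.
  rewrite -[in LHS]xE -rep_mul wk ?rep_mul //; exact: LM.
apply: (intertwiner_unitary linV) => // z.
pose VL : {linear H -> K} := HB.pack V (GRing.isLinear.Build _ _ _ _ _ linV).
have VE x : V x = VL x by [].
pose M := [set z | exists x, V x = z].
have Msub : subspace M.
  split=> [|c _ _ [u <-] [v <-]]; first by exists 0; rewrite VE linear0.
  by exists (c *: u + v); rewrite linV.
have spanM z' : M z' ->
    exists c : 'I_n -> R[i], z' = \sum_(i < n) c i *: V (b i).
  move=> [x <-]; have [c ->] := spanb x; exists c.
  by rewrite VE linear_sum; apply: eq_bigr => i _; rewrite linearZ.
have Minv a z' : M z' -> M (sigma a z').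
  by move=> [x <-]; exists (pi a x); rewrite intV.
have Mcl := finite_subspace_closed Msub spanM.
have [M0|MT] := sigma_irr.2 M Mcl Msub.1 Msub.2 Minv.
  have : M (V (pi a1 y)) by exists (pi a1 y).
  by rewrite M0 /= /V wk // => a1k0; rewrite a1k0 eqxx in a1k.
by have : M z by rewrite MT.
Qed.

End Intertwiners.

(** * The support projection in representations *)

Section SupportProjection.
Variables (R : realType) (A : cstarAlgType R).

Section Coefficients.
Variables (H : hilbertType R) (pi : star_rep A H).

Let linear_coefficient x y : linear (fun T : blin H H => hdot (T x) y : R[i]^o).
Proof. by move=> c S T; rewrite /= hdotDl hdotZl. Qed.

Let bound_coefficient x y (T : blin H H) :
  rnorm (hdot (T x) y : R[i]^o) <= rnorm y * rnorm x * rnorm T.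
Proof.
apply: (le_trans (hdot_bound _ _)); rewrite -mulrA ler_wpM2l ?rnorm_ge0 //.
by rewrite mulrC; exact: opnormP.
Qed.

Definition coefficient x y : dual (blin H H) :=
  Blin (bound_mem_blin (linear_coefficient x y) (bound_coefficient x y)).

(** Matrix coefficients separate the points of [B(H)], so that identities
    between elements of the bidual can be read off in representations of [A]
    without the Hahn-Banach theorem. *)
Lemma rep_bidual_eq0 a : rep_bidual pi (to_bidual a) = 0 <-> pi a = 0.
Proof.
split=> [a0|a0]; last by apply/blinP => f /=; rewrite a0 linear0.
apply/blinP => x; apply: hdot_inj => y.
have := congr1 (fun X : bidual (blin H H) => X (coefficient x y)) a0.
by rewrite /= => h; rewrite [LHS]hdot_sym h conjc0 hdot0r.
Qed.

End Coefficients.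

Variables (H : hilbertType R) (pi : star_rep A H) (s : A).
Hypothesis s_supp : support_projection pi (to_bidual s).

(** Such an [a] lies in [e A^**], and [(I - e) e = 0]. *)
Lemma support_kernel a : pi a = 0 -> to_bidual (cmul s a) = 0.
Proof.
have [I [e [I1 [[ee _ _] eE] sE]]] := s_supp.
move=> /rep_bidual_eq0 a0.
have : [set X | rep_bidual pi X = 0] (to_bidual a) by [].
rewrite -eE => -[X _ XE].
rewrite to_bidualM sE -XE; apply/blinP => f.
have -> : bimul (I - e) (bimul e X) f
  = bimul I (bimul e X) f - bimul e (bimul e X) f by [].
by rewrite (I1 _).1 bimulA ee subrr.
Qed.

(** In the bidual, [s a - a = - e a], which [pi^**] kills. *)
Lemma support_unit a : pi (cmul s a) = pi a.
Proof.
have [I [e [I1 [_ eE] sE]]] := s_supp.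
apply/eqP; rewrite -subr_eq0 -linearB; apply/eqP/rep_bidual_eq0.
have : [set bimul e X | X in setT] (bimul e (to_bidual (- a))).
  by exists (to_bidual (- a)).
rewrite eE => kere; apply: etrans kere; congr (blin_fun (rep_bidual pi) _).
apply/blinP => f.
have -> : to_bidual (cmul s a - a) f = to_bidual (cmul s a) f - to_bidual a f.
  exact: (linearB f).
rewrite to_bidualM sE.
have -> : bimul (I - e) (to_bidual a) f
   = bimul I (to_bidual a) f - bimul e (to_bidual a) f by [].
rewrite (I1 _).1 addrAC subrr add0r.
rewrite /= -(linearN e); congr (e _); apply/blinP => b /=.
by rewrite linearNr linearN.
Qed.

(** The vectors killed by [sigma (ker pi)] form a closed invariant subspace
    [Y].  It is not [K], as otherwise [ker pi] would lie in [ker sigma]; hence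
    it is 0.  It contains the range of [sigma s^*]. *)
Lemma support_vanishes (K : hilbertType R) (sigma : star_rep A K) :
    finite_dimensional H -> irreducible_rep pi -> irreducible_rep sigma ->
    ~ unitarily_equivalent sigma pi ->
  sigma s = 0.
Proof.
move=> H_fin pi_irr sigma_irr neq.
pose Y := [set x | forall a, pi a = 0 -> sigma a x = 0].
have YE : Y = \bigcap_(a in [set a | pi a = 0]) (sigma a @^-1` [set 0]).
  by apply/seteqP; split.
have Ycl : closed Y.
  by rewrite YE; apply: closed_bigI => a _; exact: blin_kernel_closed.
have kerM b a : pi b = 0 -> pi (cmul b a) = 0.
  by move=> b0; apply/blinP => x; rewrite rep_mul b0.
have kerS a : pi a = 0 -> pi (cstar a) = 0.
  move=> a0; apply/blinP => x; apply: hdot_inj => y.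
  by rewrite -rep_starr a0 /= linear0l linear0r.
have Y0 : Y 0 by move=> a _; rewrite linear0.
have YL (c : R[i]) x y : Y x -> Y y -> Y (c *: x + y).
  by move=> Yx Yy a a0; rewrite blin_linear Yx // Yy // scaler0 addr0.
have Yinv a x : Y x -> Y (sigma a x).
  by move=> Yx b b0; rewrite -rep_mul Yx //; exact: kerM.
have [Y1|YT] := sigma_irr.2 Y Ycl Y0 YL Yinv; last first.
  case: neq; apply: kernel_le_equivalent => // a a0; apply/blinP => x.
  have : Y x by rewrite YT.
  exact.
have ss0 x : sigma (cstar s) x = 0.
  have : Y (sigma (cstar s) x); last by rewrite Y1.
  move=> a a0; rewrite -rep_mul.
  have -> : cmul a (cstar s) = cstar (cmul s (cstar a)).
    by rewrite cstarM cstarK.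
  apply: hdot_inj => y; rewrite -rep_starr.
  have /rep_bidual_eq0 -> : rep_bidual sigma (to_bidual (cmul s (cstar a))) = 0.
    by rewrite support_kernel ?linear0 //; exact: kerS.
  by rewrite /= linear0l linear0r.
apply/blinP => x; apply: hdot_inj => y.
by rewrite hdot0r -rep_star ss0 linear0l.
Qed.

End SupportProjection.

(** * Strong peaking *)

Section OneByOne.
Variables (R : realType) (H : hilbertType R) (T : blin H H).

Lemma l2norm1 (x : 'I_1 -> H) : l2norm x = rnorm (x 0).
Proof. by rewrite /l2norm big_ord1 sqrtr_sqr ger0_norm ?rnorm_ge0. Qed.

Lemma mxopnorm1 : mxopnorm (const_mx T : 'M[blin H H]_1) = opnorm T.
Proof.
congr (sup _); apply/seteqP; split=> [_ [x /= x1 <-]|_ [x /= x1 <-]].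
  exists (x 0); first by rewrite /= -l2norm1.
  by rewrite l2norm1 big_ord1 mxE.
exists (fun=> x); first by rewrite /= l2norm1.
by rewrite l2norm1 big_ord1 mxE.
Qed.

End OneByOne.

Theorem lemma3p8 (R : realType) (A : cstarAlgType R) (H : hilbertType R)
    (pi : star_rep A H) (s : A)
    (pi_fin : finite_dimensional H)
    (pi_irr : irreducible_rep pi)
    (s_supp : support_projection pi (to_bidual s)) :
  peaks_strongly (const_mx s : 'M[A]_1) pi.
Proof.
apply: (@le_lt_trans _ _ 0%E).
  apply: ge_ereal_sup => r [-> //|[K [sigma [sigma_irr neq ->]]]].
  rewrite map_const_mx mxopnorm1 (support_vanishes s_supp) //.
  by rewrite -rnorm_blin rnorm0.
rewrite map_const_mx mxopnorm1 lte_fin lt_def opnorm_ge0 andbT.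
have [a [x ax]] := pi_irr.1.
apply: contra_neq ax => /opnorm_eq0 s0.
by rewrite -(support_unit s_supp) rep_mul s0.
Qed.
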